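(* Let $\Omega$ be a compact metric space, let $\mathbb{T}=\mathbb{Z}$ or $\mathbb{T}=\mathbb{R}$, and let $\Phi_t(x)=\omega_t(x)\odot\tau_t(x)$ be a flow on $\Omega$ with time $\mathbb{T}$, transversal action $\omega$ and translation function $\tau$ with respect to a flow $\varphi_t(x)=x\odot t$, preserving the order on the leaves of $\varphi$ (all as defined in the context). Suppose that the translation number $\rho(\Phi)$ exists and is $(\varphi,\omega)$-irrational, and that $\Phi$ has bounded mean motion. Then $\Phi$ has a unique minimal set.
   Context: Setting. $\varphi:\mathbb{R}\times\Omega\to\Omega$, $(t,x)\mapsto\varphi_t(x)=x\odot t$, is a continuous flow ($\mathbb{R}$-action) on the compact metric space $\Omega$. The leaf of $x$ is $\varphi_{\mathbb{R}}(x)=\{\varphi_t(x)\mid t\in\mathbb{R}\}$. $\omega:\mathbb{T}\times\Omega\to\Omega$, $(t,x)\mapsto\omega_t(x)$, is a continuous flow with time $\mathbb{T}$ commuting with $\varphi$: $\omega_s(x\odot t)=\omega_s(x)\odot t$ (the transversal action). $\tau:\mathbb{T}\times\Omega\to\mathbb{R}$, $(t,x)\mapsto\tau_t(x)$, is a continuous function (the translation function) with $$\tau_{s+t}(x)=\tau_s(\omega_t(x)\odot\tau_t(x))+\tau_t(x)\qquad (s,t\in\mathbb{T},\ x\in\Omega),$$ so that $\Phi_t(x)=\omega_t(x)\odot\tau_t(x)$ defines a flow on $\Omega$ with time $\mathbb{T}$. It is assumed that $\Phi$ preserves the order on leaves: $t+\tau_s(x\odot t)\geq\tau_s(x)$ for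 all $x\in\Omega$, $t\geq0$, $s\in\mathbb{T}$. Definitions. For $\rho\in\mathbb{R}$ the translation flow $T^\rho$ is $T^\rho_t(x)=\omega_t(x)\odot t\rho$, $t\in\mathbb{T}$. The number $\rho$ is $(\varphi,\omega)$-irrational if $T^\rho$ is minimal. If the limit $\rho(\Phi)=\lim_{t\to\infty}\tau_t(x)/t$ exists and is independent of $x\in\Omega$, it is called the translation number of $\Phi$. $\Phi$ has bounded mean motion if there is $C>0$ with $|\tau_t(x)-t\rho(\Phi)|\leq C$ for all $x\in\Omega$, $t\in\mathbb{T}$. A minimal set of $\Phi$ is a non-empty compact $\Phi$-invariant set containing no proper subset with these properties. *)

(* Defs.v *)
From HB Require Import structures.
From mathcomp Require Import all_boot all_order all_algebra.
From mathcomp Require Import all_classical all_reals all_analysis.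

Set Implicit Arguments.
Unset Strict Implicit.
Unset Printing Implicit Defensive.

Import Order.TTheory GRing.Theory Num.Theory.
Import numFieldNormedType.Exports.
Local Open Scope classical_set_scope.
Local Open Scope ring_scope.

(* The time group is a subset [T] of [R] (the integers or all of [R]).  A map
   with time [T] is a total function on [R] whose values outside [T] are never
   used. *)
Definition time_Z (R : realType) : set R := range (fun n : int => n%:~R).
Definition time_R (R : realType) : set R := [set: R].
Arguments time_Z R : clear implicits.
Arguments time_R R : clear implicits.

Section flows.
Context {R : realType} {Omega : metricType R}.
Implicit Types (T : set R) (f phi omega : R -> Omega -> Omega).
Implicit Types (tau : R -> Omega -> R) (M N : set Omega) (rho : R).

Definition is_flow T f : Prop :=
  [/\ forall x, f 0 x = x,
      forall s t x, T s -> T t -> f (s + t) x = f s (f t x) &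
      {within T `*` [set: Omega],
        continuous (fun p : R * Omega => f p.1 p.2)}].

Definition is_invariant T f M : Prop := forall t, T t -> f t @` M = M.

Definition compact_invariant T f M : Prop :=
  [/\ M !=set0, compact M & is_invariant T f M].

Definition minimal_set T f M : Prop :=
  compact_invariant T f M /\
  forall N, N `<=` M -> compact_invariant T f N -> N = M.

Definition minimal_flow T f : Prop := minimal_set T f [set: Omega].

Definition is_transversal_action T phi omega : Prop :=
  is_flow T omega /\
  forall s t x, T s -> omega s (phi t x) = phi t (omega s x).

(* [twisted_flow phi omega tau t x] is omega_t(x) (.) tau_t(x). *)
Definition twisted_flow phi omega tau : R -> Omega -> Omega :=
  fun t x => phi (tau t x) (omega t x).

Definition is_translation_function T phi omega tau : Prop :=
  {within T `*` [set: Omega],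
    continuous (fun p : R * Omega => tau p.1 p.2)} /\
  forall s t x, T s -> T t ->
    tau (s + t) x = tau s (twisted_flow phi omega tau t x) + tau t x.

Definition preserves_leaf_order T phi tau : Prop :=
  forall x t s, 0 <= t -> T s -> tau s x <= t + tau s (phi t x).

Definition translation_flow phi omega rho : R -> Omega -> Omega :=
  fun t x => phi (t * rho) (omega t x).

Definition flow_irrational T phi omega rho : Prop :=
  minimal_flow T (translation_flow phi omega rho).

Definition is_translation_number T tau rho : Prop :=
  forall x, tau t x / t @[t --> within T (+oo : set_system R)] --> rho.

Definition bounded_mean_motion T tau rho : Prop :=
  exists C : R, 0 < C /\ forall x t, T t -> `|tau t x - t * rho| <= C.

End flows.

(* Main.v *)
Require Import Defs.
From HB Require Import structures.
From mathcomp Require Import all_boot all_order all_algebra.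
From mathcomp Require Import all_classical all_reals all_analysis.
From mathcomp Require Import lra.
Import Order.TTheory GRing.Theory Num.Theory.
Import numFieldNormedType.Exports.
Local Open Scope classical_set_scope.
Local Open Scope ring_scope.

(* With a_t(x) = tau_t(x) - t rho, bounded by hypothesis, put H = sup_t a_t and
   L = inf_t a_t.  The function H - L is Phi-invariant and lower semicontinuous,
   hence constant on every minimal set M of Phi; since H is lower and L upper
   semicontinuous, H is continuous on M.  Then h(x) = x (.) H(x) semiconjugates
   Phi on M to the minimal flow T^rho, so h(M) = Omega.
   Fix a leaf, parametrised by t.  As Phi preserves the order, t + H is monotone
   on it, and by h(M) = Omega it takes every value u at a parameter of M, for
   each minimal set M.  If the parameters of two minimal sets were disjoint,
   every fibre of t + H would contain a nondegenerate interval, hence a rational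
   number, and R would be countable.  So any two minimal sets meet. *)

(** * Existence of minimal sets, and equality of those that meet *)

Section minimal_sets.
Context {R : realType} {Omega : metricType R}.
Implicit Types (T : set R) (f : R -> Omega -> Omega) (M N : set Omega).

(** What the integers and the reals share, so that both time groups are treated at once. *)
Definition time_group T : Prop :=
  [/\ T 0, forall s t, T s -> T t -> T (s + t) & forall t, T t -> T (- t)].

Lemma time_groupP T : T = time_Z R \/ T = time_R R -> time_group T.
Proof.
case=> ->; last by split.
split; first by exists 0.
- by move=> _ _ [m _ <-] [n _ <-]; exists (m + n) => //; rewrite rmorphD.
- by move=> _ [m _ <-]; exists (- m) => //; rewrite rmorphN.
Qed.

Definition is_action T f : Prop :=
  (forall x, f 0 x = x) /\
  (forall s t x, T s -> T t -> f (s + t) x = f s (f t x)).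

(** Times are invertible: x = f_t(f_{-t}(x)) upgrades inclusion of the image to equality. *)
Lemma invariantP T f M : time_group T -> is_action T f ->
  is_invariant T f M <-> (forall t x, T t -> M x -> M (f t x)).
Proof.
move=> [_ _ TN] [f0 fD]; split=> [Minv t x Tt Mx|Mf t Tt].
  by rewrite -(Minv t Tt); exists x.
apply/seteqP; split=> [_ [x Mx <-]|x Mx]; first exact: Mf.
exists (f (- t) x); first by apply: Mf => //; exact: TN.
by rewrite -fD ?subrr ?f0//; exact: TN.
Qed.

(** The intersection is compact and invariant, so both minimalities apply to it. Uniqueness is
    thereby reduced to showing that two minimal sets meet. *)
Lemma minimal_set_meet_eq T f M N : time_group T -> is_action T f ->
  minimal_set T f M -> minimal_set T f N -> M `&` N !=set0 -> M = N.
Proof.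
move=> hT hf [[M0 cM Minv] Mmin] [[N0 cN Ninv] Nmin] MN0.
have MNci : compact_invariant T f (M `&` N).
  split=> //.
    by apply: compact_closedI => //; apply: compact_closed => //;
      exact: metric_hausdorff.
  apply/(invariantP _ _ _ hT hf) => t x Tt [Mx Nx].
  by split; [move: Mx|move: Nx]; apply: (invariantP _ _ _ hT hf).1.
transitivity (M `&` N); first by apply/esym/Mmin => //; exact: subIsetl.
by apply: Nmin => //; exact: subIsetr.
Qed.

(** The chain is a filter base; its cluster point lies in every member, compact sets being
    closed. *)
Lemma compact_chain_meet (A : set (set Omega)) :
  compact [set: Omega] -> A !=set0 ->
  (forall M, A M -> M !=set0 /\ compact M) ->
  (forall M N, A M -> A N -> M `<=` N \/ N `<=` M) ->
  \bigcap_(M in A) M !=set0.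
Proof.
move=> cO [M0 AM0] Acpt Atot.
have FF : ProperFilter (filter_from A id).
  apply: filter_from_proper => [|M /Acpt[]//].
  apply: filter_from_filter; first by exists M0.
  move=> M N AM AN; have [MN|NM] := Atot _ _ AM AN.
    by exists M => // x Mx; split=> //; exact: MN.
  by exists N => // x Nx; split=> //; exact: NM.
have [|x [_ clx]] := cO (filter_from A id) FF; first by exists M0.
exists x => M AM.
have clM : closed M.
  by apply: compact_closed; [exact: metric_hausdorff|exact: (Acpt _ AM).2].
by apply: clM => B Bx; apply: clx => //; exists M.
Qed.

Lemma exists_minimal_set T f : time_group T -> is_action T f ->
  compact [set: Omega] -> [set: Omega] !=set0 ->
  exists M, minimal_set T f M.
Proof.
move=> hT hf cO O0.
pose X := {M : set Omega | compact_invariant T f M}.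
have XT : compact_invariant T f [set: Omega].
  by split=> //; apply/(invariantP _ _ _ hT hf).
(* Reversed inclusion: a maximal element in Zorn's lemma is then a minimal set. *)
pose le (M N : X) : bool := `[< sval N `<=` sval M >].
have [||||M Mmin] := @Zorn X le.
- by move=> M; apply/asboolP.
- move=> M N P /asboolP NM /asboolP PN; apply/asboolP.
  exact: subset_trans PN NM.
- move=> [M ?] [N ?] /asboolP/= NM /asboolP/= MN; apply: eq_exist.
  by apply/seteqP.
- move=> A Atot; have [[M0 AM0]|A0] := pselect (A !=set0); last first.
    exists (exist _ _ XT) => M AM; by case: A0; exists M.
  pose A' := sval @` A.
  have meet0 : \bigcap_(M in A') M !=set0.
    apply: compact_chain_meet => //; first by exists (sval M0); exists M0.
      by move=> _ [[M [M0' cM Minv]] AM <-].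
    move=> _ _ [M AM <-] [N AN <-].
    by case: (Atot M N AM AN) => /asboolP; [right|left].
  have ci : compact_invariant T f (\bigcap_(M in A') M).
    split=> //.
      apply: subclosed_compact cO _ => //; apply: closed_bigI => _ [M AM <-].
      by apply: compact_closed; [exact: metric_hausdorff|case: (svalP M)].
    apply/(invariantP _ _ _ hT hf) => t x Tt Mx N [P AP <-].
    have [_ _ /(invariantP _ _ _ hT hf) Pinv] := svalP P.
    by apply: Pinv => //; apply: Mx; exists P.
  exists (exist _ _ ci) => M AM; apply/asboolP => x /=; apply.
  by exists M.
exists (sval M); split; first exact: svalP.
move=> N NM Nci.
by rewrite -(Mmin (exist _ _ Nci) _)//; apply/asboolP.
Qed.

End minimal_sets.

(** Monotonicity stands in for continuity of [g]: in the application, H is known to be continuous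
    only on minimal sets. *)
Lemma monotone_common_preimage (R : realType) (g : R -> R) (P Q : set R) :
  {homo g : s t / s <= t} ->
  (forall u, exists2 s, P s & g s = u) ->
  (forall u, exists2 s, Q s & g s = u) ->
  P `&` Q !=set0.
Proof.
move=> gmono gP gQ; apply/set0P/negP => /eqP PQ0.
have gsurj : [set: R] = (fun q : rat => g (ratr q)) @` setT.
  apply/esym; rewrite -subTset => u _.
  suff [s [t [st gs gt]]] : exists s t, [/\ s < t, g s = u & g t = u].
    have [q] := rat_in_itvoo st; rewrite in_itv/= => /andP[sq qt].
    exists q => //; apply/eqP; rewrite eq_le -{1}gt -gs.
    by rewrite !gmono ?ltW.
  have [s Ps gs] := gP u; have [t Qt gt] := gQ u.
  have [st|ts|st] := ltgtP s t; [by exists s, t|by exists t, s|].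
  suff : (P `&` Q) s by rewrite PQ0.
  by split=> //; rewrite st.
(* The contradiction comes from measure: a countable set is null, but [0, 1] has measure 1. *)
have cR : countable [set: R].
  rewrite gsurj; apply: sub_countable (card_image_le _ _) _.
  exact: countableP.
have cI : countable `[0 : R, 1].
  by apply: sub_countable cR; exact: subset_card_le.
have := countable_lebesgue_measure0 cI.
rewrite lebesgue_measure_itv/= lte_fin ltr01 sube0 => /eqP.
by rewrite eqe oner_eq0.
Qed.

(** Continuity of tau is given only within T x Omega; fixing a time in T removes this
    restriction. *)
Lemma within_section_continuous {S X Y : topologicalType} (A : set S)
    (F : S * X -> Y) (s : S) :
  A s -> {within A `*` [set: X], continuous F} ->
  continuous (fun x => F (s, x)).
Proof.
move=> As /subspace_continuousP Fc x.
have {}Fc := Fc (s, x) (conj As I).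
apply: cvg_comp Fc => U /= [[V W] [/= Vs Wx] VWU].
rewrite /nbhs/=; apply: filterS Wx => y Wy.
by apply: (VWU (s, y)) => //; split=> //=; exact: nbhs_singleton.
Qed.

(** * The twisted flow as a group action *)

Section twisted_flows.
Context {R : realType} {Omega : metricType R}.
Variables (T : set R) (phi omega : R -> Omega -> Omega).
Variables (tau : R -> Omega -> R) (rho C : R).
Hypothesis hT : time_group T.
Hypothesis hphi : is_flow (time_R R) phi.
Hypothesis homega : is_transversal_action T phi omega.
Hypothesis htau : is_translation_function T phi omega tau.
Hypothesis hord : preserves_leaf_order T phi tau.
Hypothesis hC : forall x t, T t -> `|tau t x - t * rho| <= C.

Local Notation Phi := (twisted_flow phi omega tau).
Local Notation TT := (translation_flow phi omega rho).

Let T0 : T 0. Proof. by case: hT. Qed.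

Let phi0 x : phi 0 x = x. Proof. by case: hphi. Qed.

Let phiD s t x : phi (s + t) x = phi s (phi t x).
Proof. by case: hphi => _ h _; exact: h. Qed.

Let phi_cvg {X : Type} {F : set_system X} {FF : Filter F} (a : X -> R)
    (b : X -> Omega) (r : R) (y : Omega) :
  a z @[z --> F] --> r -> b z @[z --> F] --> y ->
  phi (a z) (b z) @[z --> F] --> phi r y.
Proof.
move=> ar br; apply: (cvg_comp2 ar br).
case: hphi => _ _; rewrite /time_R setXTT => /subspace_continuousP.
move=> /(_ (r, y) I) /= h U /h {}h.
have {}h : \forall q \near (r, y), [set: R * Omega] q -> U (phi q.1 q.2) := h.
by apply: filterS h => q; exact.
Qed.

Let tau_cont t : T t -> continuous (tau t).
Proof.
by case: htau => h _ Tt; exact: (within_section_continuous T _ t Tt h).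
Qed.

(* Along a leaf, [Phi 0] is a continuous idempotent at bounded distance from the
   identity; the latter makes it onto, hence it is the identity. *)
Lemma translation_function0 x : tau 0 x = 0.
Proof.
have tauB y : `|tau 0 y| <= C by have := hC y 0 T0; rewrite mul0r subr0.
(* [g] is Phi_0 in the leaf parameter: Phi_0(x (.) t) = x (.) g(t). *)
pose g t := t + tau 0 (phi t x).
have gc : continuous g.
  move=> t; apply: cvgD; first exact: cvg_id.
  apply: (@cvg_comp _ _ _ (phi^~ x) (tau 0)); last exact: (tau_cont 0 T0).
  by apply: phi_cvg; [exact: cvg_id|exact: cvg_cst].
have C0 : 0 <= C by apply: le_trans (tauB x).
have [|||t _ gt0] := @IVT R g (- C) C 0.
- by lra.
- exact: continuous_subspaceT.
- have gN : g (- C) <= 0.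
    by have := tauB (phi (- C) x); rewrite ler_norml /g => /andP[_]; lra.
  have gP : 0 <= g C.
    by have := tauB (phi C x); rewrite ler_norml /g => /andP[+ _]; lra.
  by rewrite ge_min gN/= le_max gP orbT.
have [_ tauD] := htau.
(* Since g(t) = 0, Phi_0 sends x (.) t to x, and the cocycle identity at times 0, 0 leaves tau_0(x)
   = 0. *)
have := tauD 0 0 (phi t x) T0 T0.
have [[omega0 _ _] _] := homega.
rewrite /twisted_flow omega0 addr0 -phiD addrC -[tau 0 (phi t x) + t]addrC.
rewrite -/(g t) gt0 phi0; lra.
Qed.

Lemma twisted_flow_action : is_action T Phi.
Proof.
have [[omega0 omegaD _] omega_phi] := homega; have [_ tauD] := htau.
split=> [x|s t x Ts Tt].
  by rewrite /twisted_flow translation_function0 phi0.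
by rewrite {1}/twisted_flow tauD// omegaD// phiD -omega_phi.
Qed.

(** * Deviations from the mean motion *)

Definition devs x : set R := [set tau t x - t * rho | t in T].
(** [height] and [depth] are H and L. By [hC] the deviations are bounded, so neither [sup] nor [inf]
    takes its default value. *)
Definition height x : R := sup (devs x).
Definition depth x : R := inf (devs x).

Let devs_neq0 x : devs x !=set0.
Proof. by exists (tau 0 x - 0 * rho); exists 0. Qed.

Let devs_ub x : has_ubound (devs x).
Proof.
by exists C => _ [t Tt <-]; apply: le_trans (hC x t Tt); exact: ler_norm.
Qed.

Let devs_lb x : has_lbound (devs x).
Proof.
by exists (- C) => _ [t Tt <-]; have := hC x t Tt; rewrite ler_norml => /andP[].
Qed.

Let le_height t x : T t -> tau t x - t * rho <= height x.
Proof. by move=> Tt; apply: ub_le_sup => //; exists t. Qed.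

Let ge_depth t x : T t -> depth x <= tau t x - t * rho.
Proof. by move=> Tt; apply: ge_inf => //; exists t. Qed.

Let height_le x c :
  (forall t, T t -> tau t x - t * rho <= c) -> height x <= c.
Proof. by move=> h; apply: ge_sup => // _ [t Tt <-]; exact: h. Qed.

(** The cocycle identity reads a_t(Phi_s(x)) = a_{t+s}(x) - a_s(x); take suprema over t, using T + s
    = T. *)
Lemma height_twisted_flow s x : T s ->
  height (Phi s x) = height x - tau s x + s * rho.
Proof.
move=> Ts; have [_ TD TN] := hT; have [_ tauD] := htau.
apply/eqP; rewrite eq_le; apply/andP; split.
  apply: height_le => t Tt.
  have := le_height (t + s) x (TD _ _ Tt Ts).
  by rewrite tauD// mulrDl; lra.
suff : height x <= height (Phi s x) + tau s x - s * rho by lra.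
apply: height_le => t Tt.
have Tts : T (t - s) by apply: TD => //; exact: TN.
have := le_height (t - s) (Phi s x) Tts.
have -> : tau t x = tau (t - s) (Phi s x) + tau s x by rewrite -tauD// subrK.
by rewrite mulrBl; lra.
Qed.

(** Order preservation makes t + a_r(x (.) t) nondecreasing in t for each r, and this passes to the
    supremum over r. *)
Lemma height_leaf_mono x :
  {homo (fun t => t + height (phi t x)) : s t / s <= t}.
Proof.
move=> s t st; suff : height (phi s x) <= t - s + height (phi t x) by lra.
apply: height_le => r Tr.
have := hord (phi s x) (t - s) r; rewrite -phiD subrK subr_ge0 => /(_ st Tr).
have := le_height r (phi t x) Tr; lra.
Qed.

(* The oscillation of the deviations is a [Phi]-invariant function whose
   sublevel sets are closed. *)
Lemma oscillation_minimal M x y s t : minimal_set T Phi M -> M x -> M y ->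
  T s -> T t ->
  (tau t y - t * rho) - (tau s y - s * rho) <= height x - depth x.
Proof.
move=> [[M0 cM Minv] Mmin] Mx My Ts Tt.
have [_ TD TN] := hT; have [_ tauD] := htau.
pose c := height x - depth x.
pose D p y := (tau p.2 y - p.2 * rho) - (tau p.1 y - p.1 * rho).
(* The points of M whose oscillation is at most that of x, cut out by closed conditions, one for
   each pair of times. *)
pose N := M `&` \bigcap_(p in T `*` T) [set y | D p y <= c].
suff NM : N = M by move: My; rewrite -NM => -[_ /(_ (s, t))]; apply.
apply: Mmin; first exact: subIsetl.
split.
- exists x; split=> // -[s' t'] [/= Ts' Tt']; rewrite /D /c/=.
  by have := le_height t' x Tt'; have := ge_depth s' x Ts'; lra.
- apply: compact_closedI => //; apply: closed_bigI => -[s' t'] [/= Ts' Tt'].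
  rewrite -[X in closed X]/(D (s', t') @^-1` [set r | r <= c]).
  apply: preimage_closed; last exact: closed_le.
  move=> z _.
  by apply: cvgB; apply: cvgB; [exact: tau_cont|exact: cvg_cst|
    exact: tau_cont|exact: cvg_cst].
- apply/(invariantP _ _ _ hT twisted_flow_action) => r z Tr [Mz Nz]; split.
    by apply: (invariantP _ _ _ hT twisted_flow_action).1.
  move=> [s' t'] [/= Ts' Tt'].
  (* Moving z by Phi_r shifts both times by r; the common term a_r(z) cancels in the difference. *)
  have := Nz (s' + r, t' + r) (conj (TD _ _ Ts' Tr) (TD _ _ Tt' Tr)).
  by rewrite /D/= !tauD// !mulrDl; lra.
Qed.

(** Below: some a_t nearly attains H(x) and is continuous. Above: H(y) <= a_s(y) + H(x) - L(x), by
    the oscillation bound, where a_s nearly attains L(x) at x. *)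
Lemma height_continuous_minimal M : minimal_set T Phi M ->
  {within M, continuous height}.
Proof.
move=> Mmin; apply/subspace_continuousP => x Mx.
suff near_height (e : R) : 0 < e ->
    \forall y \near within M (nbhs x), `|height x - height y| < e.
  by apply/cvgrPdist_lt => e; exact: near_height.
move=> e0.
have [_ [t Tt <-] te] := sup_adherent e0 (conj (devs_neq0 x) (devs_ub x)).
have [_ [s Ts <-] se] := inf_adherent e0 (conj (devs_neq0 x) (devs_lb x)).
have dev_cont r : T r -> (tau r y - r * rho) @[y --> within M (nbhs x)] -->
    (tau r x - r * rho).
  move=> Tr; apply: cvg_within_filter.
  by apply: cvgB; [exact: tau_cont|exact: cvg_cst].
have {}te : \forall y \near within M (nbhs x), height x - e < tau t y - t * rho.
  exact: cvgr_gt (dev_cont t Tt) _ te.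
have {}se : \forall y \near within M (nbhs x), tau s y - s * rho < depth x + e.
  exact: cvgr_lt (dev_cont s Ts) _ se.
near=> y.
have My : M y by near: y; exact: withinT.
have ty : height x - e < tau t y - t * rho by near: y.
have sy : tau s y - s * rho < depth x + e by near: y.
have hy := le_height t y Tt.
have : height y <= tau s y - s * rho + (height x - depth x).
  apply: height_le => r Tr.
  by have := oscillation_minimal _ _ _ s r Mmin Mx My Ts Tr; lra.
rewrite ltr_norml => ?.
by apply/andP; split; lra.
Unshelve. all: by end_near. Qed.

(** * Semiconjugacy to the translation flow *)

Definition leaf_projection x := phi (height x) x.

Lemma leaf_projection_minimal_onto M : flow_irrational T phi omega rho ->
  minimal_set T Phi M -> leaf_projection @` M = [set: Omega].
Proof.
move=> [_ irr] Mmin; apply: irr => //.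
have [[M0 cM Minv] _] := Mmin.
have [_ omega_phi] := homega.
split.
- by case: M0 => x Mx; exists (leaf_projection x); exists x.
- apply: continuous_compact cM; apply/subspace_continuousP => x Mx.
  apply: phi_cvg; last exact: cvg_within.
  by have /subspace_continuousP := height_continuous_minimal _ Mmin; apply.
- move=> s Ts.
  (* Both sides equal omega_s(x) (.) (H(x) + s rho). *)
  have semiconj x : TT s (leaf_projection x) = leaf_projection (Phi s x).
    rewrite /leaf_projection height_twisted_flow// /translation_flow.
    rewrite omega_phi// /twisted_flow -!phiD; congr phi; lra.
  rewrite -{2}(Minv s Ts); apply/seteqP; split=> [_ [_ [x Mx <-] <-]|].
    by exists (Phi s x); [exists x|rewrite semiconj].
  by move=> _ [_ [x Mx <-] <-]; exists (leaf_projection x);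
    [exists x|rewrite semiconj].
Qed.

(** Surjectivity gives x in M with x (.) H(x) = y (.) u, so x lies on the leaf of y at parameter u -
    H(x). *)
Lemma leaf_meets_minimal M y u : flow_irrational T phi omega rho ->
  minimal_set T Phi M ->
  exists2 t, M (phi t y) & t + height (phi t y) = u.
Proof.
move=> irr /(leaf_projection_minimal_onto _ irr) onto.
have [x Mx hx] : (leaf_projection @` M) (phi u y) by rewrite onto.
have xE : x = phi (u - height x) y.
  by rewrite addrC phiD -hx /leaf_projection -phiD addNr phi0.
by exists (u - height x); rewrite -xE// subrK.
Qed.

End twisted_flows.

Theorem corollary1p4 (R : realType) (Omega : metricType R) (T : set R)
    (phi omega : R -> Omega -> Omega) (tau : R -> Omega -> R) (rho : R)
    (hOmega : compact [set: Omega])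
    (hT : T = time_Z R \/ T = time_R R)
    (hphi : is_flow (time_R R) phi)
    (homega : is_transversal_action T phi omega)
    (htau : is_translation_function T phi omega tau)
    (hord : preserves_leaf_order T phi tau)
    (hrho : is_translation_number T tau rho)
    (hirr : flow_irrational T phi omega rho)
    (hbmm : bounded_mean_motion T tau rho) :
  exists! M : set Omega, minimal_set T (twisted_flow phi omega tau) M.
Proof.
have {}hT := time_groupP _ hT.
have [C [_ hC]] := hbmm.
have act := twisted_flow_action _ _ _ _ _ _ hT hphi homega htau hC.
(* Minimality of the translation flow includes that Omega is non-empty. *)
have [[ne _ _] _] := hirr.
have [M Mmin] := exists_minimal_set _ _ hT act hOmega ne.
exists M; split=> // N Nmin.
apply: (minimal_set_meet_eq _ _ _ _ hT act Mmin Nmin).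
(* Any leaf will do; [P K] collects the parameters at which the leaf of [y] meets [K]. *)
have [y _] := ne.
pose P (K : set Omega) := [set t | K (phi t y)].
have [|||t [Mt Nt]] := @monotone_common_preimage R
  (fun t => t + height T tau rho (phi t y)) (P M) (P N).
- exact: (height_leaf_mono _ _ _ _ _ hT hphi hord hC).
- by move=> u; exact: (leaf_meets_minimal _ _ _ _ _ _ hT hphi homega htau hC M).
- by move=> u; exact: (leaf_meets_minimal _ _ _ _ _ _ hT hphi homega htau hC N).
by exists (phi t y).
Qed.
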